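(* Let $M$ be a linear maximal monotone operator on a real Hilbert space with resolvent $L=(I+M)^{-1}$. For the AA candidate $\hat y=\sum_i\gamma_ix_{k-\mu+i}$ with $\sum_i\gamma_i=1$, $$r(\hat y)=\sum_i\gamma_i\,(Lx_{k-\mu+i}-x_{k-\mu+i})=\sum_i\gamma_iLr_{k-\mu+i}=L\Big(\sum_i\gamma_ir_{k-\mu+i}\Big).$$ Hence the true residual of the candidate equals $L$ applied to the AA surrogate, AA minimizes $\|r(\hat y)\|$ up to the factor $\|L\|\le1$ over the affine hull of the window, and $\|r(\hat y)\|\le\|r_k\|$.
   Context: $r(y)=Ly-y$ is the fixed-point residual. AA($m$) (Anderson acceleration with memory $m$) for the proximal point method: given $y_0$, set $x_k=Ly_k$ and $r_k=x_k-y_k$; at iteration $k\ge1$ with $\mu=\min(m,k)$, choose $\gamma^k\in\arg\min\{\|\sum_{i=0}^{\mu}\gamma_ir_{k-\mu+i}\|^2:\gamma\in\mathbb{R}^{\mu+1},\ \sum_i\gamma_i=1\}$ and set $y_{k+1}=\sum_{i=0}^{\mu}\gamma^k_ix_{k-\mu+i}$. The AA candidate is this point $\hat y=y_{k+1}$ with coefficients $\gamma=\gamma^k$; the AA surrogate is the combined residual $\sum_i\gamma_ir_{k-\mu+i}$, whose norm AA minimizes; the window is $x_{k-\mu},\dots,x_k$, with the corresponding residuals. *)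

(* Defs.v *)
From HB Require Import structures.
From mathcomp Require Import all_boot all_order all_algebra.
From mathcomp Require Import all_classical all_reals all_analysis.

Set Implicit Arguments.
Unset Strict Implicit.
Unset Printing Implicit Defensive.

Import Order.TTheory GRing.Theory Num.Theory.
Import numFieldNormedType.Exports.

Local Open Scope classical_set_scope.
Local Open Scope ring_scope.

(* A real Hilbert space is a complete normed module [H] together with a
   symmetric positive definite bilinear form that induces its norm. *)
Definition induces_norm (R : realType) (H : completeNormedModType R)
    (ip : {dot H for (@idfun R)}) : Prop :=
  forall u : H, ip u u = `|u| ^+ 2.

Section Operators.
Context {R : realType} {H : completeNormedModType R}.
Variable ip : {dot H for (@idfun R)}.

(* Operators are set-valued, [M u] being the (possibly empty) set of values of
   [M] at [u].  [linear_op M] says that the graph of [M] is a linear subspace;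
   for a single-valued [M], that its domain is a subspace on which it acts
   linearly. *)
Definition linear_op (M : H -> set H) : Prop :=
  M 0 0 /\
  forall (a : R) (u v u' v' : H),
    M u u' -> M v v' -> M (a *: u + v) (a *: u' + v').

Definition monotone_op (M : H -> set H) : Prop :=
  forall u v u' v' : H, M u u' -> M v v' -> 0 <= ip (u - v) (u' - v').

Definition maximal_monotone (M : H -> set H) : Prop :=
  monotone_op M /\
  forall N : H -> set H, monotone_op N ->
    (forall u, M u `<=` N u) -> forall u, N u `<=` M u.

Definition id_plus (M : H -> set H) (u : H) : set H := [set u + v | v in M u].

Definition inverse_op (A : H -> set H) (x : H) : set H := [set u | A u x].

(* [inverse_op (id_plus M) x] has exactly one point when [M] is maximal monotone
   (Minty); the default value 0 is used only when that set is empty. *)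
Definition resolvent (M : H -> set H) (x : H) : H :=
  xget 0 (inverse_op (id_plus M) x).

Definition residual (L : H -> H) (y : H) : H := L y - y.

(* Extended-real valued, so that an unbounded [L] has norm [+oo]. *)
Definition opnorm (L : H -> H) : \bar R :=
  ereal_sup [set `|L u|%:E | u in [set u : H | `|u| <= 1]].

End Operators.

Section AndersonAcceleration.
Context {R : realType} {H : completeNormedModType R}.

Definition affine_weights (n : nat) (c : 'rV[R]_n) : Prop :=
  \sum_(i < n) c 0 i = 1.

(* With mu = min(m, k): sum_(i = 0)^mu c_i u_(k - mu + i). *)
Definition window_comb (m k : nat) (c : 'rV[R]_(minn m k).+1) (u : nat -> H) : H :=
  \sum_(i < (minn m k).+1) c 0 i *: u (k - minn m k + i)%N.

Definition AA_coeffs (m k : nat) (r : nat -> H) (g : 'rV[R]_(minn m k).+1) : Prop :=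
  affine_weights g /\
  forall c : 'rV[R]_(minn m k).+1, affine_weights c ->
    `|window_comb g r| ^+ 2 <= `|window_comb c r| ^+ 2.

(* [y] is a run of AA(m) for the fixed-point map [L], with coefficient vector
   [gamma k] at iteration [k].  The iteration starts at [k = 1], so [y 0] and
   [y 1] are both free; the usual choice is [y 1 = L (y 0)]. *)
Definition AA_run (L : H -> H) (m : nat) (y : nat -> H)
    (gamma : forall k : nat, 'rV[R]_(minn m k).+1) : Prop :=
  forall k : nat, (1 <= k)%N ->
    AA_coeffs (fun j => L (y j) - y j) (gamma k) /\
    y k.+1 = window_comb (gamma k) (fun j => L (y j)).

End AndersonAcceleration.

(* Main.v *)
Require Import Defs.
From HB Require Import structures.
From mathcomp Require Import all_boot all_order all_algebra.
From mathcomp Require Import all_classical all_reals all_analysis.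
From mathcomp Require Import ring lra.
Import Order.TTheory GRing.Theory Num.Theory.
Import numFieldNormedType.Exports.
Local Open Scope classical_set_scope.
Local Open Scope ring_scope.

(* Minty's theorem for a linear maximal monotone [M]: the range of [I + M] is a
   closed subspace, and if [w] is orthogonal to it, adding [(w, w)] to the graph
   of [M] keeps [M] monotone; so [2w] lies in the range, whence [w = 0]. Thus [L]
   is everywhere defined, and it inherits linearity from the graph and
   nonexpansiveness from monotonicity. *)

Lemma cvg_of_sqr_dist_le (R : realType) (H : completeNormedModType R)
    (s : nat -> H) (b : nat -> R) :
  b @ \oo --> (0 : R) ->
  (forall n p, `|s n - s p| ^+ 2 <= b n + b p) -> cvg (s @ \oo).
Proof.
move=> b0 sb; apply: cauchy_cvg; apply: cauchy_exP => e e0.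
have e2 : 0 < e ^+ 2 / 2 by rewrite divr_gt0 // exprn_gt0.
have [N _ bN] : \forall n \near \oo, b n < e ^+ 2 / 2 by exact: cvgr_lt b0 _ e2.
exists (s N), N => // n /= Nn; rewrite -ball_normE /=.
rewrite -(@ltr_pXn2r _ 2) ?nnegrE ?(ltW e0) //.
apply: le_lt_trans (sb N n) _.
by rewrite (splitr (e ^+ 2)) ltrD // bN /=.
Qed.

(** * Hilbert space geometry: continuity of the inner product and orthogonal projection *)

Section InnerProduct.
Context {R : realType} {H : completeNormedModType R}.
Variable ip : {dot H for (@idfun R)}.
Hypothesis hip : induces_norm ip.

Let ipDl u v w : ip (u + v) w = ip u w + ip v w. Proof. exact: linearDl. Qed.
Let ipDr u v w : ip w (u + v) = ip w u + ip w v. Proof. exact: linearDr. Qed.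
Let ipNl u w : ip (- u) w = - ip u w. Proof. exact: linearNl. Qed.
Let ipNr u w : ip w (- u) = - ip w u. Proof. exact: linearNr. Qed.
Let ipZl a u w : ip (a *: u) w = a * ip u w. Proof. exact: linearZl_LR. Qed.
Let ipZr a u w : ip w (a *: u) = a * ip w u. Proof. exact: linearZr_LR. Qed.
Let ipC u v : ip u v = ip v u. Proof. by rewrite hermC /= expr0 mul1r. Qed.
Let ipE := (ipDl, ipDr, ipNl, ipNr, ipZl, ipZr).

Lemma sqr_normD (u v : H) :
  `|u + v| ^+ 2 = `|u| ^+ 2 + 2 * ip u v + `|v| ^+ 2.
Proof. by rewrite -!hip !ipE (ipC v u); ring. Qed.

Lemma parallelogram (u v : H) :
  `|u + v| ^+ 2 + `|u - v| ^+ 2 = 2 * `|u| ^+ 2 + 2 * `|v| ^+ 2.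
Proof. by rewrite -!hip !ipE (ipC v u); ring. Qed.

(** Polarization writes [ip] through norms alone, so continuity of the norm suffices. *)
Lemma cvg_ip (u v : nat -> H) (a b : H) :
  u @ \oo --> a -> v @ \oo --> b ->
  (fun n => ip (u n) (v n)) @ \oo --> ip a b.
Proof.
move=> ua vb.
have polar x y : ip x y = 2^-1 * (`|x + y| ^+ 2 - `|x| ^+ 2 - `|y| ^+ 2).
  by rewrite sqr_normD; field.
under eq_fun do rewrite polar.
rewrite polar; apply: cvgMr.
have sqr_cvg (f : nat -> H) c : f @ \oo --> c ->
    (fun n => `|f n| ^+ 2) @ \oo --> `|c| ^+ 2.
  move=> fc; rewrite expr2; under eq_fun do rewrite expr2.
  by apply: cvgM; apply: cvg_norm.
apply: cvgB; last exact: sqr_cvg.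
by apply: cvgB; apply: sqr_cvg => //; exact: cvgD.
Qed.

Lemma orthogonal_of_minimal (w s : H) :
  (forall t : R, `|w| <= `|w - t *: s|) -> ip w s = 0.
Proof.
move=> wmin; have [->|s0] := eqVneq s 0; first exact: linear0r.
have ns : 0 < `|s| ^+ 2 by rewrite exprn_gt0 // normr_gt0.
(* This [t] minimizes the squared norm of [w - t *: s], lowering it by [c ^+ 2] over the squared
   norm of [s]; minimality at [t = 0] forces [c = 0]. *)
have := wmin (ip w s / `|s| ^+ 2).
rewrite -(@ler_pXn2r _ 2) ?nnegrE // -scaleNr sqr_normD ipZr normrZ exprMn.
rewrite -normrX sqrrN ger0_norm ?sqr_ge0 //; set c := ip w s.
have -> : `|w| ^+ 2 + 2 * (- (c / `|s| ^+ 2) * c) +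
    (c / `|s| ^+ 2) ^+ 2 * `|s| ^+ 2 = `|w| ^+ 2 - c ^+ 2 / `|s| ^+ 2 by field; rewrite normr_eq0.
rewrite -subr_ge0 addrAC subrr add0r oppr_ge0 pmulr_lle0 ?invr_gt0 // => c2.
by apply/eqP; rewrite -sqrf_eq0 eq_le c2 sqr_ge0.
Qed.

(** Hilbert projection: a minimizing sequence for the distance to [x] is Cauchy, and its limit is a
    nearest point. Closedness is sequential, the form in which the range of [I + M] supplies it. *)
Lemma orthogonal_projection (S : set H) (x : H) :
  S 0 -> (forall (a : R) u v, S u -> S v -> S (a *: u + v)) ->
  (forall (s : nat -> H) l, (forall n, S (s n)) -> s @ \oo --> l -> S l) ->
  exists2 p, S p & forall z, S z -> ip (x - p) z = 0.
Proof.
move=> S0 Slin Scl.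
pose E := [set `|x - s| ^+ 2 | s in S]; pose D := inf E.
have Einf : has_inf E.
  split; first by exists (`|x - 0| ^+ 2), 0.
  by exists 0 => _ [s _ <-]; exact: sqr_ge0.
have Dle s : S s -> D <= `|x - s| ^+ 2.
  by move=> Ss; apply: ge_inf; [case: Einf|exists s].
have /choice[s Hs] :
    forall n : nat, exists s, S s /\ `|x - s| ^+ 2 < D + harmonic n.
  move=> n; have [_ [s Ss <-] lt] := inf_adherent (@harmonic_gt0 R n) Einf.
  by exists s.
have /cvg_ex[p sp] : cvg (s @ \oo).
  apply: (@cvg_of_sqr_dist_le _ _ _ (fun n => 2 * harmonic n)).
    by rewrite -(mulr0 2); apply: cvgMr; exact: cvg_harmonic.
  move=> n q; have [Sn dn] := Hs n; have [Sq dq] := Hs q.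
  (* The midpoint lies in [S], so its squared distance to [x] is at least [D]; the parallelogram law
     then leaves at most [2 * harmonic n + 2 * harmonic q] for the squared gap. *)
  have Smid : S (2^-1 *: (s n + s q)).
    rewrite -[_ *: _]addr0; apply: (Slin) => //.
    by rewrite -[s n]scale1r; apply: Slin.
  have := Dle _ Smid; have := parallelogram (x - s n) (x - s q).
  have -> : x - s n + (x - s q) = 2 *: (x - 2^-1 *: (s n + s q)).
    rewrite scalerBr scalerA divff // scale1r scaler_nat mulr2n opprD.
    by rewrite addrACA.
  have -> : x - s n - (x - s q) = - (s n - s q).
    by rewrite opprB addrC addrA subrK opprB.
  rewrite normrN normrZ exprMn ger0_norm //; lra.
have pmin : `|x - p| ^+ 2 <= D.
  have cD : (fun n => D + @harmonic R n) @ \oo --> D.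
    by rewrite -[X in _ --> X]addr0; apply: cvgD; [exact: cvg_cst|exact: cvg_harmonic].
  have cs : (fun n => `|x - s n| ^+ 2) @ \oo --> `|x - p| ^+ 2.
    rewrite expr2; under eq_fun do rewrite expr2.
    by apply: cvgM; apply: cvg_norm; apply: cvgB => //; exact: cvg_cst.
  by apply: ler_cvg_to cs cD _; apply: nearW => n; rewrite ltW //; have [] := Hs n.
have Sp : S p by apply: Scl sp => n; have [] := Hs n.
(* Moving [p] along [z] stays in [S], so [x - p] is shortest on its line of direction [z]. *)
exists p => // z Sz; apply: orthogonal_of_minimal => t.
rewrite -(@ler_pXn2r _ 2) ?nnegrE //; apply: le_trans pmin _.
by rewrite -addrA -opprD [p + _]addrC; apply: Dle; apply: Slin.
Qed.

(** * Linear maximal monotone operators: Minty's theorem and the resolvent *)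

Section LinearMaximalMonotone.
Variable M : H -> set H.
Hypotheses (hlin : linear_op M) (hmax : maximal_monotone ip M).

Let M00 : M 0 0. Proof. by case: hlin. Qed.

Let MB u v u' v' : M u u' -> M v v' -> M (u - v) (u' - v').
Proof.
move=> Mu Mv; rewrite addrC -scaleN1r [u' - _]addrC -(scaleN1r v').
by case: hlin => _; apply.
Qed.

Lemma linear_monotone_ge0 (u v : H) : M u v -> 0 <= ip u v.
Proof.
by case: hmax => mono _ Muv; have := mono _ _ _ _ Muv M00; rewrite !subr0.
Qed.

(** Maximality as a membership test: adjoining the single pair [(a, b)] to the graph preserves
    monotonicity. *)
Lemma maximal_monotone_mem (a b : H) :
  (forall u v, M u v -> 0 <= ip (a - u) (b - v)) -> M a b.
Proof.
move=> hab; case: hmax => mono maxi.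
pose N u : set H := [set v | M u v \/ u = a /\ v = b].
apply: (maxi N) => [u v u' v'|u v|]; last by right.
- case=> [Mu|[-> ->]] [Mv|[-> ->]]; [exact: mono| | exact: hab |].
    by rewrite -opprB -[u' - b]opprB ipNl ipNr opprK; exact: hab.
  by rewrite !subrr linear0r.
- by left.
Qed.

(** Monotonicity against the pair [(0, 0)] makes the cross term of the squared norm nonnegative.
    This estimate drives the closed range, the uniqueness of the resolvent and its
    nonexpansiveness. *)
Lemma norm_le_normD (u v : H) : M u v -> `|u| <= `|u + v|.
Proof.
move=> /linear_monotone_ge0 uv.
rewrite -(@ler_pXn2r _ 2) ?nnegrE // sqr_normD.
by have := sqr_ge0 `|v|; lra.
Qed.

(** The monotonicity inequality against each fixed pair of the graph survives the limit. *)
Lemma graph_closed (u v : nat -> H) (a b : H) :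
  (forall n, M (u n) (v n)) -> u @ \oo --> a -> v @ \oo --> b -> M a b.
Proof.
move=> Muv ua vb; apply: maximal_monotone_mem => c d Mcd.
have cip : (fun n => ip (u n - c) (v n - d)) @ \oo --> ip (a - c) (b - d).
  by apply: cvg_ip; apply: cvgB => //; exact: cvg_cst.
apply: ler_cvg_to (cvg_cst (0 : R)) cip _; apply: nearW => n.
by case: hmax => mono _; exact: mono.
Qed.

Lemma range_id_plus_closed (s : nat -> H) (l : H) :
  (forall n, exists u, id_plus M u (s n)) -> s @ \oo --> l ->
  exists u, id_plus M u l.
Proof.
move=> /choice[u Hu] sl.
have Muv n : M (u n) (s n - u n).
  by have [v Mv <-] := Hu n; rewrite addrC addKr.
have /cvg_ex[a ua] : cvg (u @ \oo).
  (* By linearity of the graph, [I + M] never shrinks distances: gaps of [u] are at most those of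
     [s], which the parallelogram law around [l] bounds. *)
  apply: (@cvg_of_sqr_dist_le _ _ _ (fun n => 2 * `|s n - l| ^+ 2)).
    rewrite -(mulr0 2); apply: cvgMr; rewrite -(mulr0 0).
    under eq_fun do rewrite expr2.
    have c0 : (fun n => `|s n - l|) @ \oo --> (0 : R).
      rewrite -(@normr0 _ H) -(subrr l); apply: cvg_norm.
      by apply: cvgB => //; exact: cvg_cst.
    exact: cvgM.
  move=> n q.
  have := norm_le_normD _ _ (MB _ _ _ _ (Muv n) (Muv q)).
  rewrite addrACA -opprD !subrKC => le.
  have := parallelogram (s n - l) (s q - l).
  have -> : s n - l - (s q - l) = s n - s q by rewrite opprB addrA subrK.
  have := sqr_ge0 `|s n - l + (s q - l)|.
  move: le; rewrite -(@ler_pXn2r _ 2) ?nnegrE //; lra.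
exists a; exists (l - a); last by rewrite addrC subrK.
by apply: (graph_closed _ _ _ _ Muv ua); exact: cvgB.
Qed.

Lemma id_plus_surjective (x : H) : exists u, id_plus M u x.
Proof.
pose S : set H := [set z | exists u, id_plus M u z].
have S0 : S 0 by exists 0, 0; rewrite ?addr0.
have Slin (a : R) u v : S u -> S v -> S (a *: u + v).
  move=> [c [c' Mc <-]] [d [d' Md <-]].
  exists (a *: c + d), (a *: c' + d'); first by case: hlin => _; apply.
  by rewrite scalerDr addrACA.
have [p Sp orth] := orthogonal_projection S x S0 Slin range_id_plus_closed.
have [w ew] : exists w, w = x - p by exists (x - p).
rewrite -ew in orth.
(* For [(u, v)] in the graph, [ip (w - u) (w - v)] is [ip w w - ip w (u + v) + ip u v]; the middle
   term vanishes since [u + v] is in the range. *)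
have Mww : M w w.
  apply: maximal_monotone_mem => u v Muv.
  have : ip w (u + v) = 0 by apply: orth; exists u, v.
  have := linear_monotone_ge0 _ _ Muv; have := hip w; have := sqr_ge0 `|w|.
  by rewrite !ipE (ipC u w); lra.
have Sww : S (w + w) by exists w, w.
have : ip w (w + w) = 0 by exact: orth.
have -> : x = p + w by rewrite ew subrKC.
rewrite ipDr hip -mulr2n => /eqP.
rewrite mulrn_eq0 /= sqrf_eq0 normr_eq0 => /eqP ->.
by rewrite addr0; exact: Sp.
Qed.

Let L := resolvent M.

Lemma resolvent_graph (x : H) : M (L x) (x - L x).
Proof.
(* Surjectivity ensures that the default value 0 of [xget] is never taken. *)
have [v Mv e] : id_plus M (L x) x by exact: (xgetPex 0 (id_plus_surjective x)).
by rewrite -{2}e addrC addKr.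
Qed.

(** Subtracting two solutions gives a graph pair whose components sum to 0, so [norm_le_normD] kills
    the first component. *)
Lemma resolvent_unique (u x : H) : M u (x - u) -> L x = u.
Proof.
move=> Mu; have := norm_le_normD _ _ (MB _ _ _ _ (resolvent_graph x) Mu).
rewrite addrACA -opprD !subrKC subrr normr0 normr_le0 subr_eq0.
by move/eqP.
Qed.

Lemma resolvent_linear (a : R) (x z : H) : L (a *: x + z) = a *: L x + L z.
Proof.
apply: resolvent_unique.
rewrite opprD addrACA -scalerBr.
by case: hlin => _; apply; exact: resolvent_graph.
Qed.

Lemma norm_resolvent_le (x : H) : `|L x| <= `|x|.
Proof. by have := norm_le_normD _ _ (resolvent_graph x); rewrite subrKC. Qed.

End LinearMaximalMonotone.
End InnerProduct.

(** * Operator norm, and linear maps acting on window combinations *)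

Lemma opnorm_le1 (R : realType) (H : completeNormedModType R)
    (L : H -> H) : (forall u, `|L u| <= `|u|) -> (opnorm L <= 1)%E.
Proof.
move=> Lle; apply: ge_ereal_sup => _ [u /= u1 <-].
by rewrite lee_fin; exact: le_trans (Lle u) u1.
Qed.

Section LinearMap.
Context {R : realType} {H : completeNormedModType R}.
Variable L : H -> H.
Hypothesis Llin : forall (a : R) u v, L (a *: u + v) = a *: L u + L v.

Let L0 : L 0 = 0.
Proof. by have := Llin (-1) 0 0; rewrite !scaleN1r !addNr. Qed.

Let LD u v : L (u + v) = L u + L v.
Proof. by have := Llin 1 u v; rewrite !scale1r. Qed.

Let LZ a u : L (a *: u) = a *: L u.
Proof. by have := Llin a u 0; rewrite L0 !addr0. Qed.

Let LB u v : L (u - v) = L u - L v.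
Proof. by rewrite LD -scaleN1r LZ scaleN1r. Qed.

(** A nonzero [u] is rescaled into the unit ball; at [u = 0] the product is 0 even if the norm is
    infinite. *)
Lemma norm_le_opnorm (u : H) : (`|L u|%:E <= opnorm L * `|u|%:E)%E.
Proof.
have [->|u0] := eqVneq u 0; first by rewrite L0 normr0 mule0.
have nu : 0 < `|u| by rewrite normr_gt0.
have -> : `|L u|%:E = (`|L (`|u|^-1 *: u)|%:E * `|u|%:E)%E.
  by rewrite LZ normrZ normfV normr_id -EFinM mulrAC mulVf ?mul1r // lt0r_neq0.
apply: lee_wpmul2r; first by rewrite lee_fin.
apply: ereal_sup_ubound; exists (`|u|^-1 *: u) => //=.
by rewrite normrZ normfV normr_id mulVf // lt0r_neq0.
Qed.

Lemma window_combB (m k : nat) (c : 'rV[R]_(minn m k).+1) (u v : nat -> H) :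
  window_comb c (fun j => u j - v j) = window_comb c u - window_comb c v.
Proof. by rewrite -sumrB; apply: eq_bigr => i _; rewrite scalerBr. Qed.

Lemma linear_window_comb (m k : nat) (c : 'rV[R]_(minn m k).+1) (u : nat -> H) :
  L (window_comb c u) = window_comb c (fun j => L (u j)).
Proof.
by rewrite /window_comb (big_morph L LD L0); apply: eq_bigr => i _; exact: LZ.
Qed.

(** The combined point is itself [L] of the combination of the [y j], so both terms of its residual
    are values of [L], which factors out. *)
Lemma residual_window_comb (m k : nat) (c : 'rV[R]_(minn m k).+1) (y : nat -> H) :
  residual L (window_comb c (fun j => L (y j))) =
  L (window_comb c (fun j => L (y j) - y j)).
Proof. by rewrite window_combB LB [L (window_comb c y)]linear_window_comb. Qed.

Lemma window_comb_residual (m k : nat) (c : 'rV[R]_(minn m k).+1) (y : nat -> H) :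
  window_comb c (fun j => L (L (y j)) - L (y j)) =
  window_comb c (fun j => L (L (y j) - y j)).
Proof. by apply: eq_bigr => i _; rewrite LB. Qed.

End LinearMap.

(** * Anderson acceleration: minimality of the surrogate and residual bounds *)

Lemma AA_coeffs_norm_le (R : realType) (H : completeNormedModType R) (m k : nat)
    (r : nat -> H) (g : 'rV[R]_(minn m k).+1) :
  AA_coeffs r g ->
  (forall c : 'rV[R]_(minn m k).+1, affine_weights c ->
     `|window_comb g r| <= `|window_comb c r|) /\ `|window_comb g r| <= `|r k|.
Proof.
move=> [_ gmin].
have le (c : 'rV[R]_(minn m k).+1) : affine_weights c -> `|window_comb g r| <= `|window_comb c r|.
  by move=> c1; rewrite -(@ler_pXn2r _ 2) ?nnegrE //; exact: gmin.
split=> //.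
(* All weight on the last window index, [k - minn m k + minn m k = k], is an admissible
   competitor. *)
have -> : r k = window_comb (delta_mx 0 ord_max : 'rV[R]_(minn m k).+1) r.
  rewrite /window_comb (bigD1 ord_max) //= mxE !eqxx scale1r subnK ?geq_minr //.
  by rewrite big1 ?addr0 // => i /negPf ni; rewrite mxE ni andbF scale0r.
apply: le; rewrite /affine_weights (bigD1 ord_max) //= mxE !eqxx.
by rewrite big1 ?addr0 // => i /negPf ni; rewrite mxE ni andbF.
Qed.

Theorem lemma2p4 (R : realType) (H : completeNormedModType R)
    (ip : {dot H for (@idfun R)}) (hip : induces_norm ip)
    (M : H -> set H) (hlin : linear_op M) (hmax : maximal_monotone ip M)
    (m : nat) (y : nat -> H) (gamma : forall k : nat, 'rV[R]_(minn m k).+1)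
    (hAA : AA_run (resolvent M) y gamma)
    (k : nat) (hk : (1 <= k)%N) :
  let L := resolvent M in
  let x := fun j : nat => L (y j) in
  let r := fun j : nat => x j - y j in
  let yhat := window_comb (gamma k) x in
  [/\ yhat = y k.+1,
      [/\ residual L yhat = window_comb (gamma k) (fun j => L (x j) - x j),
          window_comb (gamma k) (fun j => L (x j) - x j)
            = window_comb (gamma k) (fun j => L (r j))
        & window_comb (gamma k) (fun j => L (r j)) = L (window_comb (gamma k) r)],
      (opnorm L <= 1)%E /\
      (forall c : 'rV[R]_(minn m k).+1, affine_weights c ->
         residual L (window_comb c x) = L (window_comb c r) /\
         (`|residual L yhat|%:E <= opnorm L * `|window_comb c r|%:E)%E)
    & `|residual L yhat| <= `|r k|].
Proof.
move=> L x r yhat.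
have Llin := resolvent_linear ip hip M hlin hmax.
have Lle := norm_resolvent_le ip hip M hlin hmax.
have [/AA_coeffs_norm_le[gmin glast] yE] := hAA k hk.
split.
- by rewrite yE.
- split; first by rewrite window_combB -linear_window_comb.
    exact: window_comb_residual.
  by rewrite linear_window_comb.
- split; first exact: opnorm_le1.
  move=> c c1; split; first exact: residual_window_comb.
  rewrite residual_window_comb //; apply: le_trans (norm_le_opnorm _ Llin _) _.
  apply: lee_wpmul2l; last by rewrite lee_fin; exact: gmin.
  (* Multiplying the surrogate inequality by [opnorm L] needs its nonnegativity, witnessed by 0 in
     the unit ball. *)
  apply: ereal_sup_ge; exists (`|L 0|%:E); last by rewrite lee_fin.
  by exists 0 => //=; rewrite normr0.
- rewrite residual_window_comb //; apply: le_trans (Lle _) _; exact: glast.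
Qed.
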